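(* Let $Q=Q(f,g;B)$ be a non-empty base-flow polyhedron, with $B$ an integral $0$-base-polyhedron, and let $p$ be the unique fully supermodular function with $B=B'(p)$. Let $L\subseteq A$ satisfy $-\infty<f(e)<g(e)<+\infty$ for every $e\in L$. Then the minimum, over all integer-valued $x\in Q$, of the number of edges $e\in L$ with $x(e)=g(e)$ equals $$\max_{\mathcal C}\Big\{\varrho_L(\mathcal C)-\sum_{C\in\mathcal C}\big[\varrho_g(C)-\delta_f(C)-p(C)\big]\Big\},$$ where the maximum is taken over all feasible chains $\mathcal C$ of subsets of $V$. In particular, if the minimum is zero, the maximum is attained at the empty chain.
   Context: $D=(V,A)$ is a finite loopless digraph, $f:A\to\mathbb{Z}\cup\{-\infty\}$, $g:A\to\mathbb{Z}\cup\{+\infty\}$, $f\le g$. For $x\in\mathbb{R}^V$, $\widetilde x(Z)=\sum_{v\in Z}x(v)$. A base-polyhedron is $B'(p)=\{x:\widetilde x(V)=p(V),\ \widetilde x(Z)\ge p(Z)\ \forall Z\subset V\}$ for $p:2^V\to\mathbb{Z}\cup\{-\infty\}$ with $p(\emptyset)=0$, $p(V)$ finite and $p(X)+p(Y)\le p(X\cap Y)+p(X\cup Y)$ for all $X,Y$ (this $p$ is uniquely determined by a non-empty $B$, as $p(Z)=\min\{\widetilde x(Z):x\in B\}$); it is a $0$-base-polyhedron if $p(V)=0$, and integral if $p$ is integer-valued where finite. For $x:A\to\mathbb{R}$, $\psi_x(v)=\sum_{uv\in A}x(uv)-\sum_{vu\in A}x(vu)$, and $Q(f,g;B)=\{x\in\mathbb{R}^A:f\le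 x\le g,\ \psi_x\in B\}$. For $C\subseteq V$, $\varrho_g(C)$ is the sum of $g$ over edges entering $C$, $\delta_f(C)$ the sum of $f$ over edges leaving $C$. A chain $\mathcal C$ of subsets of $V$ is feasible if $\sum_{C\in\mathcal C}[\varrho_g(C)-\delta_f(C)-p(C)]<+\infty$. $\varrho_L(\mathcal C)$ denotes the number of edges of $L$ that enter at least one member of $\mathcal C$. *)

(* Defs.v *)
From HB Require Import structures.
From mathcomp Require Import all_boot all_order all_algebra.
From mathcomp Require Import classical_sets reals constructive_ereal.

Set Implicit Arguments.
Unset Strict Implicit.
Unset Printing Implicit Defensive.

Import Order.TTheory GRing.Theory Num.Theory.

Local Open Scope classical_set_scope.
Local Open Scope ring_scope.

(* Finite loopless digraphs, parallel edges allowed; a simple digraph is the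
   case where [fun e => (tail e, head e)] is injective. *)
Record digraph (V A : finType) := Digraph {
  tail : A -> V;
  head : A -> V;
  loopless : forall e, tail e != head e }.

Section Vectors.
Context {R : realType}.

(* The embedding of Z with both infinities into the extended reals. *)
Definition ext_real (a : \bar int) : \bar R := er_map intr a.

Definition integer_valued {I : Type} : set (I -> R) :=
  [set x | forall i, x i \is a Num.int].

End Vectors.

Section BasePolyhedra.
Context {V : finType}.
Implicit Types (p : {set V} -> \bar int).

(* The integer-valued (where finite) set functions defining integral
   base-polyhedra; values are in Z or -oo. *)
Definition fully_supermodular p : Prop :=
  [/\ forall Z, p Z != +oo%E,
      p finset.set0 = 0%E,
      p [set: V]%SET \is a fin_num
    & forall X Y : {set V}, (p X + p Y <= p (X :&: Y)%SET + p (X :|: Y)%SET)%E].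

Definition base_polyhedron (R : realType) p : set (V -> R) :=
  [set x | (\sum_v x v)%:E = ext_real (p [set: V]%SET) /\
           forall Z : {set V}, (ext_real (p Z) <= (\sum_(v in Z) x v)%:E)%E].

End BasePolyhedra.

Section BaseFlows.
Context {V A : finType}.
Variable D : digraph V A.

Definition net_inflow (R : realType) (x : A -> R) (v : V) : R :=
  \sum_(e | head D e == v) x e - \sum_(e | tail D e == v) x e.

Definition base_flow (R : realType) (f g : A -> \bar int) (B : set (V -> R)) :
    set (A -> R) :=
  [set x | (forall e, (ext_real (f e) <= (x e)%:E <= ext_real (g e))%E) /\
           B (net_inflow x)].

Definition enters (e : A) (C : {set V}) : bool :=
  (tail D e \notin C) && (head D e \in C).

Definition leaves (e : A) (C : {set V}) : bool :=
  (tail D e \in C) && (head D e \notin C).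

Definition in_sum (g : A -> \bar int) (C : {set V}) : \bar int :=
  (\sum_(e | enters e C) g e)%E.

Definition out_sum (f : A -> \bar int) (C : {set V}) : \bar int :=
  (\sum_(e | leaves e C) f e)%E.

(* When f < +oo, -oo < g and p < +oo, all three terms lie in Z or are +oo, so
   no indeterminate form occurs. *)
Definition slack (f g : A -> \bar int) (p : {set V} -> \bar int)
    (C : {set V}) : \bar int :=
  (in_sum g C - out_sum f C - p C)%E.

Definition chain (CC : {set {set V}}) : Prop :=
  forall C C' : {set V}, C \in CC -> C' \in CC ->
    (C \subset C') || (C' \subset C).

Definition feasible_chain (f g : A -> \bar int) (p : {set V} -> \bar int) :
    set {set {set V}} :=
  [set CC | chain CC /\ (\sum_(C in CC) slack f g p C < +oo)%E].

Definition num_entering (L : {set A}) (CC : {set {set V}}) : nat :=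
  #|[set e in L | [exists C in CC, enters e C]]%SET|.

Definition chain_value (f g : A -> \bar int) (p : {set V} -> \bar int)
    (L : {set A}) (CC : {set {set V}}) : \bar int :=
  (((num_entering L CC)%:Z)%:E - \sum_(C in CC) slack f g p C)%E.

Definition num_saturated (R : realType) (g : A -> \bar int) (L : {set A})
    (x : A -> R) : nat :=
  #|[set e in L | (x e)%:E == ext_real (g e)]%SET|.

End BaseFlows.

Definition is_min (d : Order.disp_t) (T : porderType d) (S : set T) (m : T) :
  Prop := S m /\ lbound S m.

Definition is_max (d : Order.disp_t) (T : porderType d) (S : set T) (m : T) :
  Prop := S m /\ ubound S m.

(* Main.v *)
(* A subset [L'] of [L] contains the saturated edges of [L] for some integral
   flow exactly when a flow exists for the capacities [g] lowered by one
   on [L \ L'].  By the feasibility criterion (slack nonnegative on every vertex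
   set, proved by fixing the flow one edge at a time) this means that [L'] covers
   [-s], where [s] is the slack for [g] lowered on all of [L]; [s] is submodular.
   The minimum size of a cover is computed by induction on [L], splitting on
   whether a given edge [e] is used.  The duals are vertex potentials [q], with
   value the Lovasz extension of [s] at [q] plus the convex edge costs
   [(q (head e) - q (tail e) - 1)^+].  This is an L-natural-convex function, so
   the dual solutions of the two branches can be uncrossed until one of them has
   potential difference at most 1 along [e], where it also serves for [L].  The
   level sets of an optimal potential form the required chain. *)
Require Import Defs.
From HB Require Import structures.
From mathcomp Require Import all_boot all_order all_algebra.
From mathcomp Require Import classical_sets reals constructive_ereal.
From mathcomp Require Import zify.

Set Implicit Arguments.
Unset Strict Implicit.
Unset Printing Implicit Defensive.

Import Order.TTheory GRing.Theory Num.Theory.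

Local Open Scope classical_set_scope.
Local Open Scope ring_scope.

(** * The Lovasz extension on natural-valued potentials *)

Section LovaszExtension.
Context {V : finType}.
Implicit Types (s : {set V} -> \bar int) (q : V -> nat).

(* The normalization [s V = 0] makes the extension below invariant under
   adding a constant to the potential. *)
Definition submodular s : Prop :=
  [/\ forall C, s C != -oo%E,
      s finset.set0 = 0%E,
      s [set: V]%SET = 0%E
    & forall X Y : {set V}, (s (X :&: Y)%SET + s (X :|: Y)%SET <= s X + s Y)%E].

Definition level q (i : nat) : {set V} := [set v | (i < q v)%N]%SET.

Definition lovasz s q : \bar int :=
  (\sum_(0 <= i < \max_v q v) s (level q i))%E.

Lemma level_eq0 q i : (forall v, (q v <= i)%N) -> level q i = finset.set0.
Proof. by move=> qi; apply/finset.setP => v; rewrite !inE ltnNge qi. Qed.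

(** Levels above the maximum are empty and contribute nothing, so different potentials can be summed
    over a common range. *)
Lemma lovaszE s q N : s finset.set0 = 0%E -> (forall v, (q v <= N)%N) ->
  lovasz s q = (\sum_(0 <= i < N) s (level q i))%E.
Proof.
move=> s0 qN; have mN : (\max_v q v <= N)%N by apply/bigmax_leqP => v _.
rewrite /lovasz [RHS](big_cat_nat (n := \max_v q v)) //=.
rewrite [X in (_ + X)%E]big_nat [X in (_ + X)%E]big1 ?adde0 // => i /andP[mi _].
by rewrite level_eq0 // => v; apply: leq_trans (leq_bigmax v) mi.
Qed.

Lemma sum_nat_shift (F : nat -> \bar int) N a :
  (\sum_(0 <= i < N + a) F i =
   \sum_(0 <= i < a) F i + \sum_(0 <= i < N) F (i + a)%N)%E.
Proof.
rewrite (big_cat_nat (n := a)) ?leq_addl //=.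
by rewrite -{2}[a]add0n big_addn addnK.
Qed.

Lemma bounded_potential q : exists N, forall v, (q v <= N)%N.
Proof. by exists (\max_v q v)%N => v; apply: leq_bigmax. Qed.

Lemma lovasz_neq_Ny s q : submodular s -> lovasz s q != -oo%E.
Proof.
move=> [sN _ _ _]; apply/eqP => /esum_eqNyP [i [_ _ /eqP]].
by apply/negP; apply: sN.
Qed.

Lemma lovasz_shift s q c : submodular s ->
  lovasz s (fun v => q v + c)%N = lovasz s q.
Proof.
move=> [_ s0 sT _]; have [N qN] := bounded_potential q.
rewrite (lovaszE s0 qN) (lovaszE (N := N + c) s0) => [|v]; last by rewrite leq_add2r.
rewrite sum_nat_shift [X in (X + _)%E]big_nat big1 => [|i /andP[_ ic]].
  rewrite add0e; apply: eq_bigr => i _; congr s; apply/finset.setP => v.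
  by rewrite !inE ltn_add2r.
have -> // : level (fun v => q v + c)%N i = [set: V]%SET.
by apply/finset.setP => v; rewrite !inE ltn_addl.
Qed.

(* Translation submodularity: level [i] of [p] is uncrossed with level [i + a]
   of [q]. *)
Lemma lovasz_uncross s p q a : submodular s ->
  (lovasz s (fun v => maxn (p v) (q v - a)) +
   lovasz s (fun v => minn (p v + a) (q v)) <= lovasz s p + lovasz s q)%E.
Proof.
move=> [_ s0 _ ss].
have [Np pN] := bounded_potential p; have [Nq qN] := bounded_potential q.
pose N := (Np + Nq)%N.
have {}pN v : (p v <= N)%N by have := pN v; rewrite /N; lia.
have {}qN v : (q v <= N)%N by have := qN v; rewrite /N; lia.
clearbody N.
rewrite (lovaszE s0 pN) (lovaszE (N := N) s0) => [|v]; last by have := pN v; have := qN v; lia.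
rewrite (lovaszE (q := q) (N := N + a) s0) => [|v]; last by have := qN v; lia.
rewrite (lovaszE (N := N + a) s0) => [|v]; last by have := qN v; lia.
(* The lowest [a] levels of the minimum are those of [q]; only the levels from [a] upwards meet
   levels of [p]. *)
rewrite !sum_nat_shift addeCA [leRHS]addeCA; apply: leeD.
  rewrite !big_nat; apply: lee_sum => i /andP[_ ia].
  have -> // : level (fun v => minn (p v + a) (q v)) i = level q i.
  by apply/finset.setP => v; rewrite !inE; lia.
rewrite -!big_split /=; apply: lee_sum => i _.
have -> : level (fun v => maxn (p v) (q v - a)) i = (level p i :|: level q (i + a))%SET.
  by apply/finset.setP => v; rewrite !inE; lia.
have -> : level (fun v => minn (p v + a) (q v)) (i + a) = (level p i :&: level q (i + a))%SET.
  by apply/finset.setP => v; rewrite !inE; lia.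
by rewrite addeC ss.
Qed.


(** All [t] levels of this potential equal [C]. It is the dual solution to be used when [C] is a
    violated set. *)
Lemma lovasz_indicator s C t (c : int) : s finset.set0 = 0%E -> (s C <= c%:E)%E ->
  (lovasz s (fun v => if v \in C then t else 0%N) <= (c *+ t)%:E)%E.
Proof.
move=> s0 sC; rewrite (lovaszE (N := t) s0) => [|v]; last by case: ifP.
have -> : (c *+ t)%:E = (\sum_(0 <= i < t) c%:E)%E.
  by rewrite sumEFin sumr_const_nat subn0.
rewrite !big_nat; apply: lee_sum => i /andP[_ it].
rewrite (_ : level _ i = C) //; apply/finset.setP => v; rewrite !inE.
by case: ifP.
Qed.

End LovaszExtension.

(** By integrality, exceeding both bounds costs at least 2, so one spare unit in the sum is
    harmless. *)
Lemma adde_le_or (x y : \bar int) (a b : int) :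
  x != -oo%E -> y != -oo%E -> (x + y <= (a + b + 1)%:E)%E ->
  (x <= a%:E)%E \/ (y <= b%:E)%E.
Proof.
case: x => [x||] //; case: y => [y||] // _ _; rewrite -EFinD !lee_fin => xy.
by have [xa|xa] := leP x a; [left | right; lia].
Qed.

(** * Minimum covers and their dual potentials *)

Section Covers.
Context {V A : finType} (D : digraph V A).
Implicit Types (s : {set V} -> \bar int) (q : V -> nat) (L : {set A}).

Definition in_degree L (C : {set V}) : nat := \sum_(e in L) enters D e C.

Definition covers s L : Prop :=
  forall C, (0 <= s C + (in_degree L C)%:Z%:E)%E.

Definition excess q (e : A) : nat := q (Defs.head D e) - q (tail D e) - 1.

(** The dual objective with its sign reversed: [- dual_value s L q] bounds from below the size of
    every cover contained in [L]. *)
Definition dual_value s L q : \bar int :=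
  (lovasz s q + (\sum_(e in L) excess q e)%N%:Z%:E)%E.

Lemma dual_value_neq_Ny s L q : submodular s -> dual_value s L q != -oo%E.
Proof.
by move=> /(lovasz_neq_Ny q); rewrite /dual_value; case: lovasz.
Qed.

Lemma dual_value_shift s L q c : submodular s ->
  dual_value s L (fun v => q v + c)%N = dual_value s L q.
Proof.
move=> /lovasz_shift ss; rewrite /dual_value ss; congr (_ + _%:Z%:E)%E.
by apply: eq_bigr => e _; rewrite /excess subnDr.
Qed.

Lemma dual_value_uncross s L p q a : submodular s ->
  (dual_value s L (fun v => maxn (p v) (q v - a)) +
   dual_value s L (fun v => minn (p v + a) (q v)) <=
   dual_value s L p + dual_value s L q)%E.
Proof.
move=> ss; rewrite /dual_value addeACA [leRHS]addeACA.
apply: leeD; first exact: lovasz_uncross.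
(* Each edge term is a convex function of a potential difference, hence uncrosses by itself. *)
rewrite -!EFinD lee_fin -!PoszD lez_nat -!big_split /=.
by apply: leq_sum => e _; rewrite /excess; lia.
Qed.

(* Raising [p] and lowering [q] by uncrossing yields a potential with difference
   exactly 1 along [e], and one with a smaller difference than [q]; one of the
   two has value at most [a]. *)
Lemma dual_value_narrow s L e p q (a : int) : submodular s ->
  (p (Defs.head D e) <= p (tail D e))%N ->
  (dual_value s L p <= (a + 1)%:E)%E -> (dual_value s L q <= a%:E)%E ->
  exists2 r, (r (Defs.head D e) <= r (tail D e) + 1)%N & (dual_value s L r <= a%:E)%E.
Proof.
move=> ss pe pa; have [n] := ubnP (q (Defs.head D e) - q (tail D e)).
elim: n q => // n IHn q qn qa.
have [qe|qe] := leqP (q (Defs.head D e)) (q (tail D e) + 1)%N; first by exists q.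
(* These shifts give the maximum the values [p (tail D e) + 1] at the head and [p (tail D e)] at the
   tail; in the minimum the difference along [e] is smaller than in [q] by at least one. *)
pose c := (p (tail D e) + 1)%N; pose b := q (Defs.head D e).
have := dual_value_uncross L p (fun v => q v + c)%N b ss.
rewrite dual_value_shift // => /le_trans /(_ (leeD pa qa)).
rewrite -EFinD (addrAC a) => /adde_le_or[|||r1a]; try exact: dual_value_neq_Ny.
  set r := (fun v => _) => ra; exists r => //.
  by rewrite /r /c /b; lia.
by apply: IHn r1a; rewrite /c /b; lia.
Qed.

(** The edge enters [level q i] exactly for [q (tail D e) <= i < q (head D e)]. *)
Lemma sum_enters_level q e N : (forall v, (q v <= N)%N) ->
  (\sum_(0 <= i < N) enters D e (level q i) = q (Defs.head D e) - q (tail D e))%N.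
Proof.
move=> qN; suff -> : (\sum_(0 <= i < N) enters D e (level q i) =
    minn (q (Defs.head D e)) N - q (tail D e))%N.
  by rewrite (minn_idPl (qN _)).
elim: N {qN} => [|N IHN]; first by rewrite big_geq // minn0.
by rewrite big_nat_recr //= IHN /enters !inE; lia.
Qed.

Lemma lovaszD s1 s2 q : lovasz (fun C => s1 C + s2 C)%E q = (lovasz s1 q + lovasz s2 q)%E.
Proof. exact: big_split. Qed.

Lemma lovasz_enters q e :
  lovasz (fun C => (enters D e C : nat)%:Z%:E) q =
  (q (Defs.head D e) - q (tail D e))%N%:Z%:E.
Proof.
have [N qN] := bounded_potential q.
rewrite (lovaszE _ qN) => [|/=]; last by rewrite /enters !inE andbF.
rewrite sumEFin -(sum_enters_level _ qN); congr EFin.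
by rewrite (big_morph Posz PoszD (erefl 0%:Z)).
Qed.

Lemma submodularD s1 s2 : submodular s1 -> submodular s2 ->
  submodular (fun C => s1 C + s2 C)%E.
Proof.
move=> [N1 z1 T1 sub1] [N2 z2 T2 sub2]; split => [C|||X Y].
- by have := N1 C; have := N2 C; case: (s1 C) => [x||] //; case: (s2 C).
- by rewrite z1 z2 adde0.
- by rewrite T1 T2 adde0.
- by rewrite addeACA [leRHS]addeACA leeD.
Qed.

Lemma submodular_enters e : submodular (fun C => (enters D e C : nat)%:Z%:E).
Proof.
split=> [C|||X Y] //; rewrite /enters ?inE ?andbF //.
rewrite -!EFinD lee_fin -!PoszD lez_nat.
by do 4!case: (_ \in _).
Qed.

Lemma cover_minmax s L : submodular s -> covers s L ->
  exists L', exists q : V -> nat,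
    [/\ L' \subset L, covers s L' & (dual_value s L q <= (- #|L'|%:Z)%:E)%E].
Proof.
have [n] := ubnP #|L|; elim: n s L => // n IHn s L Ln ss Lcov.
have [L0|[e eL]] := set_0Vmem L.
  exists finset.set0, (fun=> 0%N); rewrite -L0; split=> //.
  rewrite /dual_value L0 big_set0 cards0 oppr0 adde0.
  by rewrite (lovaszE (N := 0)) ?big_geq //; case: ss.
pose Le := (L :\ e)%SET.
have Le_n : (#|Le| < n)%N by have := cardsD1 e L; rewrite eL /Le; lia.
have in_degree_e C : in_degree L C = (enters D e C + in_degree Le C)%N.
  by rewrite /in_degree (big_setD1 e eL).
have dual_e q : dual_value s L q = (dual_value s Le q + (excess q e)%:Z%:E)%E.
  by rewrite /dual_value (big_setD1 e eL) /= -addeA -EFinD -PoszD addnC.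
(* Branch where [e] is used: its in-degree is absorbed into [s], and its Lovasz extension is the
   positive part of the difference of [p] along [e]. *)
have [|L1 [p [L1e L1cov p1]]] := IHn _ Le Le_n (submodularD ss (submodular_enters e)).
  by move=> C; have := Lcov C; rewrite in_degree_e PoszD EFinD addeA.
set a := #|L1| in p1.
have {}p1 : (dual_value s Le p +
    (p (Defs.head D e) - p (tail D e))%N%:Z%:E <= (- a%:Z)%:E)%E.
  by rewrite /dual_value addeAC -lovasz_enters -lovaszD.
have dual_p_le : (dual_value s Le p <= (- a%:Z)%:E)%E.
  by apply: le_trans p1; apply: leeDl; rewrite lee_fin.
(* Either not using [e] gives a cover of size at most [a], for which [p] is already a dual solution,
   or some potential shows that covers inside [Le] need more than [a] edges. *)
have [//|[q qa]] : 
    (exists L2, exists q : V -> nat,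
       [/\ L2 \subset L, covers s L2 & (dual_value s L q <= (- #|L2|%:Z)%:E)%E]) \/
    (exists q, (dual_value s Le q <= (- a%:Z - 1)%:E)%E).
  have [/forallP Lecov|] := boolP [forall C : {set V}, (0 <= s C + (in_degree Le C)%:Z%:E)%E].
    have [L2 [q [L2e L2cov q2]]] := IHn _ _ Le_n ss Lecov.
    have [L2a|aL2] := leqP #|L2| a.
      left; exists L2, p; split=> //; first exact: fintype.subset_trans L2e (finset.subsetDl _ _).
      apply: (@le_trans _ _ (- a%:Z)%:E); last by rewrite lee_fin; lia.
      rewrite dual_e; apply: le_trans p1; apply: leeD => //.
      by rewrite lee_fin /excess; lia.
    by right; exists q; apply: le_trans q2 _; rewrite lee_fin; lia.
  case/forallPn => C; rewrite -ltNge => sC; right.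
  (* Here [Le] is no cover, as [C] is violated. If [d] edges of [Le] enter [C], then
     [s C <= - d - 1], and each of them has excess [a] at height [a.+1]; the value is at most
     [(a + 1) * (- d - 1) + a * d <= - a - 1]. *)
  exists (fun v => if v \in C then a.+1 else 0%N).
  have := Lcov C; rewrite in_degree_e.
  case sCE: (s C) sC => [c||] //; rewrite -!EFinD lte_fin lee_fin => sC eC.
  rewrite /dual_value; set m := (\sum_(_ in _) _)%N.
  have m_le : (m <= in_degree Le C * a)%N.
    rewrite /in_degree big_distrl /=; apply: leq_sum => e' _.
    by rewrite /excess /enters; case: (_ \in _); case: (_ \in _); lia.
  apply: (@le_trans _ _ ((c *+ a.+1)%:E + m%:Z%:E)%E).
    by apply: leeD => //; apply: lovasz_indicator; rewrite ?sCE //; case: ss.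
  rewrite -EFinD lee_fin; case: (enters D e C) eC => eC; nia.
have Le1 : L1 \subset L by apply: fintype.subset_trans L1e (finset.subsetDl _ _).
have eL1 : e \notin L1 by apply/negP => /(fintype.subsetP L1e); rewrite !inE eqxx.
have finish r : (dual_value s L r <= (- a%:Z - 1)%:E)%E -> exists L', exists q : V -> nat,
    [/\ L' \subset L, covers s L' & (dual_value s L q <= (- #|L'|%:Z)%:E)%E].
  move=> ra; exists (e |: L1)%SET, r; split.
  - by rewrite finset.subUset finset.sub1set eL.
  - by move=> C; rewrite /in_degree (big_setU1 _ eL1) /= PoszD EFinD addeA; apply: L1cov.
  - by rewrite cardsU1 eL1 (_ : - _ = - a%:Z - 1) // /a; lia.
(* The set [L1] with [e] added is now the cover. If [p] does not increase along [e], narrowing [q]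
   against [p] removes the excess of [e]; otherwise the excess of [p] on [e] is one less than its
   difference, which supplies the missing unit. *)
have [pe|pe] := leqP (p (Defs.head D e)) (p (tail D e)).
  have [|r re ra] := dual_value_narrow ss pe _ qa; first by rewrite subrK.
  by apply: (finish r); rewrite dual_e /excess (_ : _ - _ - 1 = 0)%N ?adde0 //; lia.
apply: (finish p); rewrite dual_e.
case: (dual_value s Le p) p1 => [x||] //= p1; last by rewrite leNye.
by move: p1; rewrite -!EFinD !lee_fin /excess; lia.
Qed.

End Covers.

(** * Inequalities between extended integers *)

Lemma oppe_le_of_adde_ge0 (x y : \bar int) : x != -oo%E -> y != -oo%E ->
  (0 <= x + y)%E = (- x <= y)%E.
Proof.
case: x => [x||] //; case: y => [y||] // _ _; rewrite ?leey ?leNye //.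
by rewrite -EFinD -EFinN !lee_fin; lia.
Qed.

(* Helly's theorem for integer intervals with possibly infinite ends. *)
Lemma integer_between (I : finType) (i0 : I) (l u : I -> \bar int) :
  (forall i, l i != +oo%E) -> (forall i, u i != -oo%E) ->
  (forall i j, l i <= u j)%E ->
  exists z : int, forall i, (l i <= z%:E <= u i)%E.
Proof.
move=> lfin ufin lu.
case: (@arg_maxP _ _ _ i0 predT l isT) => i _ lmax.
case: (@arg_minP _ _ _ i0 predT u isT) => j _ umin.
case li: (l i) (lfin i) => [z||] // _.
  by exists z => k; rewrite -li lu andbT; apply: lmax.
case uj: (u j) (ufin j) => [z||] // _.
  by exists z => k; rewrite -uj lu; apply: umin.
exists 0 => k; apply/andP; split.
  by apply: le_trans (lmax k isT) _; rewrite li leNye.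
by apply: le_trans (umin k isT); rewrite uj leey.
Qed.

(** * Cut slacks and the feasibility criterion for integral flows *)

Section Slack.
Context {V A : finType} (D : digraph V A).
Implicit Types (s p : {set V} -> \bar int) (f g : A -> \bar int).

(** Writing the slack edge by edge allows the bounds of a single edge to be changed in isolation. *)
Definition edge_slack (a b : \bar int) (e : A) (C : {set V}) : \bar int :=
  if enters D e C then b else if leaves D e C then (- a)%E else 0%E.

Definition cut_slack f g (C : {set V}) : \bar int :=
  (\sum_e edge_slack (f e) (g e) e C)%E.

Lemma slackE f g p C : (forall e, f e != +oo%E) ->
  slack D f g p C = (cut_slack f g C - p C)%E.
Proof.
move=> ffin; rewrite /slack /in_sum /out_sum -sumeN; last first.
  by move=> i j _ _; have := ffin i; have := ffin j; case: (f i); case: (f j).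
rewrite big_mkcond [X in (_ + X - _)%E]big_mkcond -big_split /=.
congr (_ - _)%E; apply: eq_bigr => e _; rewrite /edge_slack /enters /leaves.
by case: (_ \in _); case: (_ \in _); rewrite ?adde0 ?add0e.
Qed.

Lemma submodular_sum (I : finType) (F : I -> {set V} -> \bar int) :
  (forall i, submodular (F i)) -> submodular (fun C => \sum_i F i C)%E.
Proof.
move=> Fs; split=> [C|||X Y].
- apply/eqP => /esum_eqNyP [i [_ _ /eqP]].
  by apply/negP; case: (Fs i).
- by apply: big1 => i _; case: (Fs i).
- by apply: big1 => i _; case: (Fs i).
- by rewrite -!big_split /=; apply: lee_sum => i _; case: (Fs i).
Qed.

(** The two sides differ only if the edge enters one of [X], [Y] and leaves the other, and then by
    [b - a]. *)
Lemma submodular_edge_slack a b e : a != +oo%E -> b != -oo%E -> (a <= b)%E ->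
  submodular (edge_slack a b e).
Proof.
move=> afin bfin ab; split=> [C|||X Y].
- rewrite /edge_slack; case: ifP => // _; case: ifP => // _.
  by case: a afin {ab}.
- by rewrite /edge_slack /enters /leaves !inE andbF.
- by rewrite /edge_slack /enters /leaves !inE.
- have ba : (0 <= b - a)%E by rewrite addeC oppe_le_of_adde_ge0 ?oppeK //; case: a afin {ab}.
  rewrite /edge_slack /enters /leaves !inE.
  by do 4![case: (_ \in _)]; rewrite /= ?adde0 ?add0e // addeC.
Qed.

Lemma submodular_opp p : fully_supermodular p -> p [set: V]%SET = 0%E ->
  submodular (fun C => - p C)%E.
Proof.
move=> [pfin p0 _ psup] pT; split=> [C|||X Y]; rewrite ?p0 ?pT ?oppe0 //.
  by have := pfin C; case: (p C).
have := psup X Y; have := pfin X; have := pfin Y.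
have := pfin (X :&: Y)%SET; have := pfin (X :|: Y)%SET.
case: (p X) => [?||] //; case: (p Y) => [?||] //=; rewrite ?leey //;
  case: (p (_ :&: _)%SET) => [?||] //; case: (p (_ :|: _)%SET) => [?||] // _ _ _ _.
by rewrite -!EFinN -!EFinD !lee_fin; lia.
Qed.

Lemma submodular_slack f g p :
  (forall e, f e != +oo%E) -> (forall e, g e != -oo%E) -> (forall e, f e <= g e)%E ->
  fully_supermodular p -> p [set: V]%SET = 0%E ->
  submodular (fun C => cut_slack f g C - p C)%E.
Proof.
move=> ffin gfin fg psup pT; apply: submodularD; last exact: submodular_opp.
by apply: submodular_sum => e; apply: submodular_edge_slack.
Qed.

(** Sets entered by [e] bound the value from below, sets left by [e] from above. A lower bound from
    [X] and an upper bound from [Y] are compatible because [e] neither enters nor leaves their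
    intersection and union, where [s] is therefore nonnegative. *)
Lemma fix_edge_value s e a b : submodular s ->
  a != +oo%E -> b != -oo%E -> (a <= b)%E ->
  (forall C, 0 <= edge_slack a b e C + s C)%E ->
  exists2 z : int, (a <= z%:E <= b)%E &
    forall C, (0 <= edge_slack z%:E z%:E e C + s C)%E.
Proof.
move=> [sN s0 _ ssub] afin bfin ab sl.
(* The default values [a] and [b] put the original bounds into the same family; the empty set
   returns them at the end. *)
pose l C := if enters D e C then (- s C)%E else a.
pose u C := if leaves D e C then s C else b.
have [||X Y|z zP] := integer_between finset.set0 (l := l) (u := u).
- by move=> C; rewrite /l; case: ifP => // _; have := sN C; case: (s C).
- by move=> C; rewrite /u; case: ifP.
- rewrite /l /u; case: ifP => eX; case: ifP => lY //.
  + rewrite -oppe_le_of_adde_ge0 //; apply: le_trans (ssub X Y).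
    move: eX lY; rewrite /enters /leaves => /andP[tX hX] /andP[tY hY].
    have := sl (X :&: Y)%SET; have := sl (X :|: Y)%SET.
    rewrite /edge_slack /enters /leaves !inE tY hX (negbTE tX) (negbTE hY) /= !add0e.
    by move=> *; apply: adde_ge0.
  + by have := sl X; rewrite /edge_slack eX addeC oppe_le_of_adde_ge0.
  + have := sl Y; rewrite /edge_slack lY ifN.
      by rewrite oppe_le_of_adde_ge0 ?oppeK //; case: (a) afin.
    by move: lY; rewrite /leaves /enters => /andP[->].
- exists z; first by have := zP finset.set0; rewrite /l /u /enters /leaves !inE andbF.
  move=> C; have := zP C; rewrite /l /u /edge_slack.
  case: ifP => eC; case: ifP => lC /andP[zl zu].
  + by move: eC lC; rewrite /enters /leaves; case: (_ \in _).
  + by rewrite addeC oppe_le_of_adde_ge0.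
  + by rewrite oppe_le_of_adde_ge0 // oppeK.
  + by have := sl C; rewrite /edge_slack eC lC.
Qed.

Lemma integral_flow f g p :
  (forall e, f e != +oo%E) -> (forall e, g e != -oo%E) -> (forall e, f e <= g e)%E ->
  fully_supermodular p -> p [set: V]%SET = 0%E ->
  (forall C, 0 <= cut_slack f g C - p C)%E ->
  exists x : A -> int, (forall e, f e <= (x e)%:E <= g e)%E /\
    forall C, (0 <= cut_slack (EFin \o x) (EFin \o x) C - p C)%E.
Proof.
move=> ffin gfin fg psup pT sl.
pose fix_on (r : seq A) (x : A -> int) (h : A -> \bar int) e :=
  if e \in r then (x e)%:E else h e.
suff [x [xb xs]] : exists x : A -> int,
    (forall e, e \in enum A -> f e <= (x e)%:E <= g e)%E /\
    forall C, (0 <= cut_slack (fix_on (enum A) x f) (fix_on (enum A) x g) C - p C)%E.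
  exists x; split=> [e|C]; first by rewrite xb ?mem_enum.
  apply: le_trans (xs C) _; apply: leeD => //; apply: lee_sum => e _.
  by rewrite /fix_on mem_enum.
elim: (enum A) => [|e r [x [xb xs]]]; first by exists (fun=> 0).
have [er|er] := boolP (e \in r).
  exists x; split=> [e'|C].
    by rewrite inE => /orP[/eqP ->|]; apply: xb.
  apply: le_trans (xs C) _; apply: leeD => //; apply: lee_sum => e' _.
  by rewrite /fix_on inE; case: eqP => // ->; rewrite er.
(* With both bounds of [e] set to 0 its edge slack vanishes, so [h 0] yields a submodular function
   free of [e], as [fix_edge_value] requires. *)
pose h z k := [eta fix_on r x k with e |-> z] : A -> \bar int.
have cutE y z C : (cut_slack (h y f) (h z g) C - p C =
    edge_slack y z e C + (cut_slack (h 0%E f) (h 0%E g) C - p C))%E.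
  rewrite /cut_slack (bigD1 e) //= [in RHS](bigD1 e) //= /h /= !eqxx addeA.
  congr (_ - _)%E; congr (_ + _)%E; rewrite [edge_slack 0 0 e C]/edge_slack oppe0 !if_same add0e.
  by apply: eq_bigr => e' /negbTE ne; rewrite ne.
have s0 : submodular (fun C => cut_slack (h 0%E f) (h 0%E g) C - p C)%E.
  by apply: submodular_slack => // e'; rewrite /h /= /fix_on; case: ifP => // _; case: ifP.
have [|z /andP[fz zg] zs] := fix_edge_value (e := e) s0 (ffin e) (gfin e) (fg e).
  move=> C; rewrite -cutE; apply: le_trans (xs C) _; apply: leeD => //.
  apply: lee_sum => e' _; rewrite /h /=; case: eqP => // ->.
  by rewrite /fix_on (negbTE er).
exists [eta x with e |-> z]; split=> [e'|C].
  by rewrite inE /=; case: eqP => [-> _|_ /=]; [rewrite fz zg | apply: xb].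
apply: le_trans (zs C) _; rewrite -cutE; apply: leeD => //; apply: lee_sum => e' _.
by rewrite /h /= /fix_on inE /=; case: eqP.
Qed.

End Slack.

(** * Real flows: weak duality, and integral flows as members of the polyhedron *)

Section RealFlows.
Context (R : realType) {V A : finType} (D : digraph V A).
Implicit Types (f g : A -> \bar int) (p : {set V} -> \bar int) (L : {set A}).

Lemma ext_realD a b : ext_real (a + b)%E = (ext_real a + ext_real b)%E :> \bar R.
Proof. by case: a => [a||]; case: b => [b||] //=; rewrite rmorphD. Qed.

Lemma ext_realN a : ext_real (- a)%E = (- ext_real a)%E :> \bar R.
Proof. by case: a => [a||] //=; rewrite rmorphN. Qed.

Lemma ext_real_le a b : (ext_real a <= ext_real b :> \bar R)%E = (a <= b)%E.
Proof.
by case: a => [a||]; case: b => [b||]; rewrite /= ?leNye ?leey // !lee_fin ler_int.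
Qed.

Lemma ext_real_sum (I : Type) (r : seq I) (P : pred I) (F : I -> \bar int) :
  ext_real (\sum_(i <- r | P i) F i)%E = (\sum_(i <- r | P i) ext_real (F i))%E :> \bar R.
Proof. exact: (big_morph _ ext_realD (erefl _)). Qed.

(** Edges with both ends in [C] cancel. *)
Lemma net_inflow_sum (x : A -> R) (C : {set V}) :
  \sum_(v in C) net_inflow D x v =
  \sum_e (if enters D e C then x e else if leaves D e C then - x e else 0).
Proof.
have by_end (k : A -> V) : \sum_(v in C) \sum_(e | k e == v) x e = \sum_(e | k e \in C) x e.
  rewrite [RHS](partition_big k (mem C)) //=; apply: eq_bigr => v vC.
  by apply: eq_bigl => e; case: eqP => [->|]; rewrite ?vC ?andbF.
rewrite sumrB !by_end big_mkcond [X in _ - X]big_mkcond -sumrB /=.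
apply: eq_bigr => e _; rewrite /enters /leaves.
by case: (_ \in C); case: (_ \in C); rewrite ?subrr ?subr0 ?sub0r.
Qed.

(** The net inflow into [C] is at least [p C], while entering edges carry at most [g - d] and
    leaving edges at least [f]. Taking [d = 0] shows that slacks are nonnegative; taking for [d] the
    indicator of the unsaturated edges of [L] gives weak duality. *)
Lemma slack_ge_residual f g p (x d : A -> R) C : (forall e, f e != +oo%E) ->
  base_flow D f g (base_polyhedron p) x ->
  (forall e, (x e + d e)%:E <= ext_real (g e))%E ->
  ((\sum_(e | enters D e C) d e)%:E <= ext_real (slack D f g p C))%E.
Proof.
move=> ffin [xb [_ xp]] xd; rewrite slackE // ext_realD ext_realN.
have -> : \sum_(e | enters D e C) d e =
    \sum_e (if enters D e C then x e + d e else if leaves D e C then - x e else 0) -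
    \sum_(v in C) net_inflow D x v.
  rewrite net_inflow_sum -sumrB big_mkcond /=; apply: eq_bigr => e _.
  by case: ifP => _; [rewrite addrC addKr | rewrite subrr].
rewrite EFinB; apply: leeB => //; rewrite ext_real_sum -sumEFin; apply: lee_sum => e _.
rewrite /edge_slack; case: ifP => // _; case: ifP => // _.
by rewrite ext_realN EFinN leeN2; case/andP: (xb e).
Qed.

(** An edge of [L] entering some member of the family is either saturated or counted at that
    member. *)
Lemma num_entering_le (sat : pred A) L (CC : {set {set V}}) :
  (num_entering D L CC <= #|[set e in L | sat e]%SET| +
     \sum_(C in CC) \sum_(e | enters D e C) ((e \in L) && ~~ sat e))%N.
Proof.
under [X in (_ + X)%N]eq_bigr do rewrite big_mkcond.
rewrite exchange_big /= /num_entering -!sum1dep_card !(big_mkcond (fun e => _ && _)).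
rewrite -big_split /=; apply: leq_sum => e _.
case: (e \in L) => //=; case: existsP => // -[C /andP[CCC eC]].
case: (sat e) => //=; rewrite add0n (bigD1 C) //= eC; exact: leq_addr.
Qed.

Lemma chain_value_le f g p (x : A -> R) L CC : (forall e, f e != +oo%E) ->
  (forall e, e \in L -> g e != +oo%E) ->
  base_flow D f g (base_polyhedron p) x -> integer_valued x ->
  (chain_value D f g p L CC <= (num_saturated g L x)%:Z%:E)%E.
Proof.
move=> ffin gL xQ xint.
pose sat e := (x e)%:E == ext_real (g e).
pose unsat e := (e \in L) && ~~ sat e.
have slack_ge C : ((\sum_(e | enters D e C) unsat e)%N%:R%:E <= ext_real (slack D f g p C) :> \bar R)%E.
  rewrite natr_sum; apply: (slack_ge_residual (x := x)) => // e.
  have [xb _] := xQ; have /andP[_ xg] := xb e; rewrite /unsat.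
  have [eL|_] := boolP (e \in L); last by rewrite addr0.
  have [_|/=] := boolP (sat e); first by rewrite addr0.
  (* By integrality an unsaturated edge of [L] has a whole unit of residual capacity. *)
  move: xg (gL e eL); rewrite /sat; case: (g e) => [z||] //=.
  have /intrP[y ->] := xint e.
  by rewrite !lee_fin eqe eqr_int -[1%:R]/(1%:~R) -intrD !ler_int; lia.
have := num_entering_le sat L CC; rewrite /chain_value -/(num_saturated g L x).
set T := (\sum_(C in CC) _)%E; set S := (\sum_(C in CC) _)%N => nS.
have ST : (S%:R%:E <= ext_real T :> \bar R)%E.
  by rewrite natr_sum -sumEFin ext_real_sum; apply: lee_sum.
case: T ST => [t||] //=; rewrite ?leNye // !lee_fin -[S%:R]/(S%:Z%:~R) ler_int.
lia.
Qed.

Lemma integral_base_flow f g p (x : A -> int) :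
  (forall e, f e <= (x e)%:E <= g e)%E -> p [set: V]%SET = 0%E ->
  (forall C, 0 <= cut_slack D (EFin \o x) (EFin \o x) C - p C)%E ->
  (base_flow D f g (base_polyhedron p) `&` integer_valued) (fun e => (x e)%:~R : R).
Proof.
move=> xb pT xs; split; last by move=> e; apply: intr_int.
split=> [e|].
  by have /andP[fx xg] := xb e; rewrite -[(_)%:E]/(ext_real (x e)%:E) !ext_real_le fx.
split=> [|C].
  have -> : \sum_v net_inflow D (fun e => (x e)%:~R : R) v =
      \sum_(v in [set: V]%SET) net_inflow D (fun e => (x e)%:~R : R) v.
    by apply: eq_bigl => v; rewrite inE.
  by rewrite net_inflow_sum pT big1 // => e _; rewrite /enters /leaves !inE.
rewrite net_inflow_sum.
have -> : (\sum_e (if enters D e C then (x e)%:~R else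
    if leaves D e C then - (x e)%:~R else 0) : R)%:E =
    ext_real (cut_slack D (EFin \o x) (EFin \o x) C).
  rewrite ext_real_sum -sumEFin; apply: eq_bigr => e _.
  by rewrite /edge_slack; case: ifP => // _; case: ifP => //= _; rewrite rmorphN.
rewrite ext_real_le; move: (xs C).
have -> : cut_slack D (EFin \o x) (EFin \o x) C =
    (\sum_e (if enters D e C then x e else if leaves D e C then - x e else 0))%:E.
  rewrite -sumEFin; apply: eq_bigr => e _.
  by rewrite /edge_slack; case: ifP => // _; case: ifP.
by rewrite sube_ge0 ?orbT.
Qed.

End RealFlows.

(** * From potentials to chains of level sets *)

Section Chains.
Context {V A : finType} (D : digraph V A).
Implicit Types (f g : A -> \bar int) (q : V -> nat) (L : {set A}).

Lemma lovasz_in_degree L q :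
  lovasz (fun C => (in_degree D L C)%:Z%:E) q =
  (\sum_(e in L) (q (Defs.head D e) - q (tail D e)))%N%:Z%:E.
Proof.
have [N qN] := bounded_potential q; rewrite (lovaszE _ qN) /=; last first.
  by rewrite /in_degree big1 // => e _; rewrite /enters !inE andbF.
rewrite sumEFin -(big_morph Posz PoszD (erefl 0%:Z)) exchange_big /=.
by under eq_bigr do rewrite (sum_enters_level _ _ qN).
Qed.

Definition lower g L e : \bar int := if e \in L then (g e - 1)%E else g e.

Lemma cut_slack_lower f g L C :
  cut_slack D f g C = (cut_slack D f (lower g L) C + (in_degree D L C)%:Z%:E)%E.
Proof.
rewrite /in_degree (big_morph Posz PoszD (erefl 0%:Z)) -sumEFin big_mkcond -big_split /=.
apply: eq_bigr => e _; rewrite /edge_slack /lower.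
by case: (e \in L); case: ifP => _; rewrite ?adde0 // subeK.
Qed.

Definition level_chain q : {set {set V}} :=
  [set level q i | i : 'I_(\max_v q v)]%SET.

Lemma chain_level_chain q : chain (level_chain q).
Proof.
move=> _ _ /imsetP[i _ ->] /imsetP[j _ ->].
by have [ij|ji] := leqP i j; apply/orP; [right|left]; apply/fintype.subsetP => v;
  rewrite !inE; lia.
Qed.

(** Equal levels are counted once in the chain but repeatedly in the extension; nonnegativity makes
    this an inequality in the right direction. *)
Lemma sum_level_chain_le (s : {set V} -> \bar int) q : (forall C, 0 <= s C)%E ->
  (\sum_(C in level_chain q) s C <= lovasz s q)%E.
Proof.
move=> s_ge0; rewrite /lovasz big_mkord.
rewrite (partition_big (fun i : 'I__ => level q i) (mem (level_chain q))) /=; last first.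
  by move=> i _; apply: imset_f.
apply: lee_sum => _ /imsetP[i _ ->]; rewrite (bigD1 i) //=; apply: leeDl.
exact: sume_ge0.
Qed.

(** An edge with positive potential difference enters the level at the height of its tail, which
    accounts for one unit; the remaining units are its excess. *)
Lemma num_entering_level_chain L q :
  (\sum_(e in L) (q (Defs.head D e) - q (tail D e)) <=
   num_entering D L (level_chain q) + \sum_(e in L) excess D q e)%N.
Proof.
rewrite /num_entering -sum1dep_card big_mkcondr /= -big_split /=.
apply: leq_sum => e _; case: existsP => [_|noC]; first by rewrite /excess; lia.
have [qe|qe] := leqP (q (Defs.head D e)) (q (tail D e)); first by rewrite /excess; lia.
have te : (q (tail D e) < \max_v q v)%N by apply: leq_trans qe (leq_bigmax _).
case: noC; exists (level q (q (tail D e))); apply/andP; split.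
  by apply/imsetP; exists (Ordinal te).
by rewrite /enters !inE ltnn.
Qed.

End Chains.

(** * The min-max theorem *)

Theorem theorem3p1 (R : realType) (V A : finType) (D : digraph V A)
  (f g : A -> \bar int)
  (f_lty : forall e, f e != +oo%E)
  (g_gtNy : forall e, g e != -oo%E)
  (f_le_g : forall e, (f e <= g e)%E)
  (B : set (V -> R)) (p : {set V} -> \bar int)
  (p_super : fully_supermodular p)
  (B_def : B = base_polyhedron p)
  (p_zero : p [set: V]%SET = 0%E)
  (Q_nonempty : base_flow D f g B !=set0)
  (L : {set A})
  (L_bounds : forall e, e \in L ->
     [/\ (-oo < f e)%E, (f e < g e)%E & (g e < +oo)%E]) :
  exists m : nat,
    [/\ is_min [set num_saturated g L x |
                 x in base_flow D f g B `&` integer_valued] m,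
        is_max [set chain_value D f g p L CC |
                 CC in feasible_chain D f g p] (m%:Z)%:E%E
      & m = 0%N ->
        feasible_chain D f g p finset.set0 /\
        chain_value D f g p L finset.set0 = (m%:Z)%:E%E].
Proof.
pose s C := (cut_slack D f (lower g L) C - p C)%E.
have gL e : e \in L -> g e != +oo%E by move=> /L_bounds[_ _]; rewrite ltey.
have lower_gtNy (M : {set A}) e : M \subset L -> lower g M e != -oo%E.
  by rewrite /lower; case: ifP => // _; case: (g e) (g_gtNy e).
have f_le_lower (M : {set A}) e : M \subset L -> (f e <= lower g M e)%E.
  move=> ML; rewrite /lower; case: ifP => // /(fintype.subsetP ML)/L_bounds[].
  case: (f e) => [a||] //; case: (g e) => [b||] // _ + _.
  by rewrite lte_fin -EFinN -EFinD lee_fin; lia.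
have s_sub : submodular s by apply: submodular_slack => // e; auto.
have slack_s C : slack D f g p C = (s C + (in_degree D L C)%:Z%:E)%E.
  by rewrite slackE // (cut_slack_lower _ f g L) addeAC.
have slack_ge0 C : (0 <= slack D f g p C)%E.
  have [x0 x0Q] := Q_nonempty; rewrite B_def in x0Q.
  have := slack_ge_residual (d := fun=> 0) C f_lty x0Q.
  rewrite big1 // -[0%:E]/(ext_real 0%E) ext_real_le; apply => e.
  by have [/(_ e)/andP[_]] := x0Q; rewrite addr0.
(* Nonnegativity of the slack says that [L] itself covers, so a minimum cover [M] and a dual
   potential [q] exist. *)
have [C|M [q [ML Mcov qM]]] := cover_minmax (D := D) (L := L) s_sub.
  by rewrite -slack_s.
have lowerD e : lower g L e = lower (lower g (L :\: M)%SET) M e.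
  rewrite /lower !inE; case: (boolP (e \in M)) => //= eM.
  by rewrite (fintype.subsetP ML).
have LM : (L :\: M)%SET \subset L by apply: finset.subsetDl.
(* Lowering on [L] is lowering on the complement of [M] in [L] and then on [M]. Hence [M] covering
   is the feasibility criterion with only the complement lowered, and the resulting flow can
   saturate edges of [L] only inside [M]. *)
have [||C|y [yb ys]] := integral_flow
    (D := D) (f := f) (g := lower g (L :\: M)%SET) f_lty _ _ p_super p_zero.
- by move=> e; apply: lower_gtNy.
- by move=> e; apply: f_le_lower.
- rewrite (cut_slack_lower _ _ _ M) addeAC; have := Mcov C; rewrite /s.
  by rewrite /cut_slack; under eq_bigr do rewrite lowerD.
have lower_le M' e : (lower g M' e <= g e)%E.
  rewrite /lower; case: ifP => // _; case: (g e) => [z||] //.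
  by rewrite -EFinN -EFinD lee_fin; lia.
have yg e : (f e <= (y e)%:E <= g e)%E.
  by have /andP[-> /le_trans] := yb e; apply.
have xQ := integral_base_flow R yg p_zero ys.
have sat_le : (num_saturated g L (fun e => (y e)%:~R : R) <= #|M|)%N.
  apply: subset_leq_card; apply/fintype.subsetP => e; rewrite !inE => /andP[eL].
  apply: contraLR => eM; have /andP[_] := yb e; rewrite /lower !inE eM eL /=.
  case: (g e) (gL e eL) (g_gtNy e) => [z||] // _ _; rewrite -EFinD lee_fin eqe eqr_int; lia.
(* The slacks along the chain sum to at most [lovasz s q] plus the positive potential differences on
   [L]. These are at most the number of edges entered plus the total excess, so optimality of [q]
   bounds the sum by that number minus the size of [M]; in particular it is finite. *)
have [CCfeas CCval] : feasible_chain D f g p (level_chain q) /\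
    (#|M|%:Z%:E <= chain_value D f g p L (level_chain q))%E.
  have := sum_level_chain_le q slack_ge0.
  have -> : lovasz (slack D f g p) q =
      lovasz (fun C => s C + (in_degree D L C)%:Z%:E)%E q.
    by apply: eq_bigr => i _; rewrite slack_s.
  rewrite lovaszD lovasz_in_degree /feasible_chain /chain_value /=.
  have T_ge0 : (0 <= \sum_(C in level_chain q) slack D f g p C)%E by apply: sume_ge0.
  move: qM (lovasz_neq_Ny q s_sub) (num_entering_level_chain D L q) T_ge0.
  rewrite /dual_value; case: (lovasz s q) => [l||] //.
  case: (\sum_(C in _) _)%E => [t||] // lM _ nL _ tl.
  split; first by split; [exact: chain_level_chain | rewrite ltry].
  by move: lM tl; rewrite -?EFinN -!EFinD !lee_fin; lia.
(* Weak duality against this chain turns the bound on saturated edges into an equality. *)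
have satE : num_saturated g L (fun e => (y e)%:~R : R) = #|M|.
  have [xQ1 xint] := xQ; apply/eqP; rewrite eqn_leq sat_le /= -lez_nat -lee_fin.
  exact: le_trans CCval (chain_value_le _ f_lty gL xQ1 xint).
have chain_value_ub CC : (chain_value D f g p L CC <= #|M|%:Z%:E)%E.
  by have [xQ1 xint] := xQ; rewrite -satE; apply: chain_value_le.
exists #|M|; split.
- split; first by exists (fun e => (y e)%:~R); rewrite ?B_def.
  move=> _ [z [zQ zint] <-]; rewrite B_def in zQ.
  rewrite leEnat -lez_nat -lee_fin.
  exact: le_trans CCval (chain_value_le _ f_lty gL zQ zint).
- split; last by move=> _ [CC _ <-]; apply: chain_value_ub.
  by exists (level_chain q) => //; apply/eqP; rewrite eq_le CCval chain_value_ub.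
- move=> M0; rewrite /feasible_chain /chain_value /= big_set0 M0 oppe0 adde0; split.
    by split=> [C C'|]; rewrite ?inE // ltry.
  congr (_%:Z%:E)%E; apply/eqP; rewrite cards_eq0 -finset.subset0.
  by apply/fintype.subsetP => e; rewrite !inE => /andP[_ /existsP[C]]; rewrite inE.
Qed.
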